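(* Let $R=\bigoplus_{n\in\mathbb{Z}}R_n$ be a strongly $\mathbb{Z}$-graded ring. Then the following are equivalent: (1) $R$ is right quasi-duo; (2) $R$ is left quasi-duo; (3) $R/J(R)$ is commutative, where $J(R)$ is the Jacobson radical of $R$.
   Context: All rings are associative with identity, not necessarily commutative. A ring is right (left) quasi-duo if every maximal right (left) ideal of it is a two-sided ideal. A $\mathbb{Z}$-graded ring is a ring $R$ with a decomposition $R=\bigoplus_{n\in\mathbb{Z}}R_n$ into additive subgroups such that $R_nR_m\subseteq R_{n+m}$ for all $n,m\in\mathbb{Z}$; it is strongly graded if $R_nR_m=R_{n+m}$ for all $n,m\in\mathbb{Z}$, where $R_nR_m$ denotes the additive subgroup generated by all products $ab$ with $a\in R_n$, $b\in R_m$. *)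

(* Defs.v *)
From HB Require Import structures.
From mathcomp Require Import all_boot all_algebra.
From mathcomp Require Import boolp classical_sets functions cardinality fsbigop.

Set Implicit Arguments.
Unset Strict Implicit.
Unset Printing Implicit Defensive.

Import GRing.Theory.
Local Open Scope classical_set_scope.
Local Open Scope ring_scope.

(* Rings are [pzRingType]: associative, unital, possibly noncommutative, and   *)
(* possibly zero. Subsets are [set R]; [ [in A] ] views the set A as a         *)
(* (classically decidable) predicate, so as to reuse [zmod_closed].            *)

Section Ideals.
Variable R : pzRingType.
Implicit Types I M A B : set R.

Definition additive_subgroup A : Prop := zmod_closed [in A].

Definition right_ideal I : Prop :=
  additive_subgroup I /\ (forall x r, I x -> I (x * r)).

Definition left_ideal I : Prop :=
  additive_subgroup I /\ (forall x r, I x -> I (r * x)).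

Definition two_sided_ideal I : Prop := right_ideal I /\ left_ideal I.

Definition maximal_right_ideal M : Prop :=
  [/\ right_ideal M, M <> [set: R] &
      forall I, right_ideal I -> M `<=` I -> I = M \/ I = [set: R]].

Definition maximal_left_ideal M : Prop :=
  [/\ left_ideal M, M <> [set: R] &
      forall I, left_ideal I -> M `<=` I -> I = M \/ I = [set: R]].

(* The additive subgroup generated by the products a * b, a in A, b in B.      *)
Definition mul_subgroup A B : set R :=
  smallest additive_subgroup [set a * b | a in A & b in B].

(* For the zero ring there is no maximal right ideal, and this is [set: R].    *)
Definition jacobson : set R := \bigcap_(M in maximal_right_ideal) M.

End Ideals.

Definition right_quasi_duo (R : pzRingType) : Prop :=
  forall M : set R, maximal_right_ideal M -> two_sided_ideal M.

Definition left_quasi_duo (R : pzRingType) : Prop :=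
  forall M : set R, maximal_left_ideal M -> two_sided_ideal M.

(* The sum below ranges over the finite support of c.                          *)
Definition internal_direct_sum (R : pzRingType) (Rn : int -> set R) : Prop :=
  forall x : R, exists! c : int -> R,
    [/\ forall n, Rn n (c n),
        finite_set [set n | c n != 0] &
        x = \sum_(n \in [set: int]) c n].

Definition Z_graded (R : pzRingType) (Rn : int -> set R) : Prop :=
  [/\ forall n, additive_subgroup (Rn n),
      internal_direct_sum Rn &
      forall n m, mul_subgroup (Rn n) (Rn m) `<=` Rn (n + m)].

Definition strongly_Z_graded (R : pzRingType) (Rn : int -> set R) : Prop :=
  Z_graded Rn /\ (forall n m, mul_subgroup (Rn n) (Rn m) = Rn (n + m)).

Section JacobsonIdeal.
Variable R : pzRingType.
Implicit Types (I M : set R) (x y r : R).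

Lemma additive_subgroupP I : additive_subgroup I <->
  (I 0 /\ forall x y, I x -> I y -> I (x - y)).
Proof.
split=> [[/set_mem I0 IB] | [I0 IB]].
  by split=> // x y Ix Iy; apply/set_mem/IB; apply/mem_set.
split; first exact/mem_set.
by move=> x y /set_mem Ix /set_mem Iy; apply/mem_set; exact: IB.
Qed.

Lemma right_ideal_unit I : right_ideal I -> I 1 -> I = [set: R].
Proof.
move=> [_ IM] I1; apply/seteqP; split=> // x _.
by rewrite -[x]mul1r; apply: IM.
Qed.

Lemma right_idealD I x y : right_ideal I -> I x -> I y -> I (x + y).
Proof.
move=> [/additive_subgroupP[I0 IB] _] Ix Iy.
by rewrite -[y]opprK; apply: (IB) => //; rewrite -sub0r; apply: IB.
Qed.

Lemma maximal_right_transporter M r : maximal_right_ideal M ->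
  ~ M r -> maximal_right_ideal [set x | M (r * x)].
Proof.
move=> [Mr MT Mmax] nMr; have [/additive_subgroupP[M0 MB] MM] := Mr.
split.
- split; last by move=> x s /=; rewrite mulrA; apply: MM.
  apply/additive_subgroupP; split=> /= [|x y]; first by rewrite mulr0.
  by rewrite mulrBr; apply: MB.
- by move/seteqP=> [_ /(_ 1 I)] /=; rewrite mulr1.
move=> N Nr sMN; have [/additive_subgroupP[N0 NB] NM] := Nr.
have [sNM | ] := pselect (N `<=` [set x | M (r * x)]).
  by left; apply/seteqP.
move=> /existsNP[y /not_implyP[Ny /= nMy]]; right.
pose K := [set z | exists m s, M m /\ z = m + r * y * s].
have Kr : right_ideal K.
  split; last first.
    move=> _ t [m [s [Mm ->]]]; exists (m * t), (s * t).
    by split; [apply: MM | rewrite mulrDl !mulrA].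
  apply/additive_subgroupP; split.
    by exists 0, 0; split; rewrite // mulr0 addr0.
  move=> _ _ [m [s [Mm ->]]] [m' [s' [Mm' ->]]].
  exists (m - m'), (s - s'); split; first exact: MB.
  by rewrite mulrBr opprD addrACA.
have sMK : M `<=` K by move=> m Mm; exists m, 0; rewrite mulr0 addr0.
have [KM | KT] := Mmax _ Kr sMK.
  case: nMy; rewrite -KM; exists 0, 1.
  by split; rewrite // mulr1 add0r.
have [m [s [Mm rE]]] : K r by rewrite KT.
apply: right_ideal_unit => //; rewrite -(subrK (y * s) 1).
apply: right_idealD => //; last exact: NM.
by apply: sMN; rewrite /= mulrBr mulr1 mulrA {1}rE addrK.
Qed.

Lemma jacobson_two_sided : two_sided_ideal (@jacobson R).
Proof.
have JZ : additive_subgroup (@jacobson R).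
  apply/additive_subgroupP; split=> [M [[/additive_subgroupP[]]] //|x y Jx Jy M].
  move=> Mmax; have [[/additive_subgroupP[_ MB] _] _ _] := Mmax.
  by apply: MB; [apply: Jx | apply: Jy].
split; split=> // x r Jx M Mmax; have [[_ MM] _ _] := Mmax.
  by apply: MM; apply: Jx.
have [Mr | nMr] := pselect (M r); first exact: MM.
exact: Jx (maximal_right_transporter Mmax nMr).
Qed.

End JacobsonIdeal.

(* The library only forms quotient rings of commutative rings; R/J(R) is the   *)
(* library's additive quotient by J(R), with the induced multiplication.       *)

Definition jacobson_pred (R : pzRingType) : {pred R} := [in @jacobson R].

HB.instance Definition _ (R : pzRingType) :=
  GRing.isZmodClosed.Build R (@jacobson_pred R) (jacobson_two_sided R).1.1.

Definition quot_jacobson (R : pzRingType) : Type :=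
  Quotient.quot (@jacobson_pred R).

Section QuotJacobson.
Variable R : pzRingType.
Local Open Scope quotient_scope.
Local Notation Q := (quot_jacobson R).
Local Notation J := (@jacobson_pred R).

HB.instance Definition _ := ZmodQuotient.copy Q (Quotient.quot J).

Definition quot_jacobson_one : Q := lift_cst Q 1.
Definition quot_jacobson_mul := lift_op2 Q *%R.

Canonical quot_jacobson_pi_one := PiConst quot_jacobson_one.

Lemma quot_jacobson_piM :
  {morph \pi_Q : x y / x * y >-> quot_jacobson_mul x y}.
Proof.
have [[_ JMr] [_ JMl]] := jacobson_two_sided R.
have Jrepr z : jacobson (z - repr (\pi_Q z)).
  by apply/set_mem; rewrite -[_ \in _]/(_ \in J) Quotient.idealrBE reprK.
move=> x y; unlock quot_jacobson_mul; apply/eqP; rewrite piE Quotient.equivE.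
rewrite -[_ * _](addrNK (x * repr (\pi_Q y))) -mulrBr.
rewrite -addrA -mulrBl rpredD //; apply/mem_set.
  by apply: JMl; apply: Jrepr.
by apply: JMr; apply: Jrepr.
Qed.
Canonical quot_jacobson_pi_mul := PiMorph2 quot_jacobson_piM.

Fact quot_jacobson_mulA : associative quot_jacobson_mul.
Proof. by move=> x y z; rewrite -[x]reprK -[y]reprK -[z]reprK !piE mulrA. Qed.

Fact quot_jacobson_mul1 : left_id quot_jacobson_one quot_jacobson_mul.
Proof. by move=> x; rewrite -[x]reprK !piE mul1r. Qed.

Fact quot_jacobson_1mul : right_id quot_jacobson_one quot_jacobson_mul.
Proof. by move=> x; rewrite -[x]reprK !piE mulr1. Qed.

Fact quot_jacobson_mulDl : left_distributive quot_jacobson_mul +%R.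
Proof.
by move=> x y z; rewrite -[x]reprK -[y]reprK -[z]reprK !piE mulrDl.
Qed.

Fact quot_jacobson_mulDr : right_distributive quot_jacobson_mul +%R.
Proof.
by move=> x y z; rewrite -[x]reprK -[y]reprK -[z]reprK !piE mulrDr.
Qed.

HB.instance Definition _ := GRing.Zmodule_isPzRing.Build Q
  quot_jacobson_mulA quot_jacobson_mul1 quot_jacobson_1mul
  quot_jacobson_mulDl quot_jacobson_mulDr.

End QuotJacobson.

Section QuotJacobsonTheory.
Variable R : pzRingType.
Local Open Scope quotient_scope.
Local Notation Q := (quot_jacobson R).

Lemma pi_jacobsonD (x y : R) : \pi_Q (x + y) = \pi_Q x + \pi_Q y.
Proof. by rewrite !piE. Qed.

Lemma pi_jacobsonM (x y : R) : \pi_Q (x * y) = \pi_Q x * \pi_Q y.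
Proof. exact: quot_jacobson_piM. Qed.

Lemma pi_jacobson1 : \pi_Q (1 : R) = 1.
Proof. by rewrite /GRing.one /= piE. Qed.

Lemma pi_jacobson_eq (x y : R) :
  \pi_Q x = \pi_Q y <-> jacobson (x - y).
Proof.
split=> [/eqP | Jxy]; last apply/eqP.
  by rewrite -Quotient.idealrBE => /set_mem.
by rewrite -Quotient.idealrBE; apply/mem_set.
Qed.

End QuotJacobsonTheory.

(* Main.v *)
Require Import Defs.
From mathcomp Require Import all_boot all_algebra.
From mathcomp Require Import boolp classical_sets.
From mathcomp Require Import cardinality fsbigop.
From mathcomp Require Import zify.

(** The core is that in a right quasi-duo strongly graded ring every maximal
    right ideal M contains every commutator; as commutators are biadditive, it
    is enough to treat c = a b - b a with a and b homogeneous.  Suppose that c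
    lies outside M.  Every maximal right ideal is two-sided, hence completely
    prime, and so the largest graded ideal inside it is completely prime on
    homogeneous elements ([graded_part_prime]).  Applied to M this gives a
    graded prime that avoids c, and Zorn's lemma enlarges it to a graded prime
    Q maximal among those that avoid c.

    Maximality turns information about ungraded ideals into information about
    Q.  Let w be homogeneous with c w outside Q and of nonzero degree.  Modulo
    Q homogeneous elements behave as in a graded domain, where 1 - c w cannot be
    right invertible because only homogeneous elements are
    ([one_sub_proper]).  So some maximal right ideal M' contains both Q and
    1 - c w; it avoids c, since otherwise it would contain 1, and therefore Q is
    the whole graded part of M'.  As M' is two-sided, it contains
    v (1 - c w) - (1 - c w) v = c w v - v c w for all homogeneous v; this is
    homogeneous, so it lies in Q ([homogeneous_central_mod]).

    Strong grading provides a homogeneous y outside Q whose degree keeps both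
    c y and c (y b) in nonzero degree.  Both then commute with a modulo Q, so
    c y c = c y (a b - b a) belongs to Q, although c and y do not: a
    contradiction ([homogeneous_commutator_maximal]).

    Hence right quasi-duo means that all commutators are in J(R), the converse
    implication being immediate.  The left-hand version is the same statement
    for the converse ring, because J(R) is the same for a ring and its converse
    ([jacobson_converse]). *)

Set Implicit Arguments.
Unset Strict Implicit.
Unset Printing Implicit Defensive.

Import GRing.Theory.
Local Open Scope classical_set_scope.
Local Open Scope ring_scope.

(** * Chains and Zorn's lemma *)

Lemma chain_bigcup2 (T : Type) (F : set (set T)) (x y : T) :
    total_on F subset -> (\bigcup_(X in F) X) x -> (\bigcup_(X in F) X) y ->
  exists X, [/\ F X, X x & X y].
Proof.
move=> totF [X FX Xx] [Y FY Yy].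
by have [XY | YX] := totF _ _ FX FY; [exists Y | exists X]; split; auto.
Qed.

(** A chain need only be bounded when it is nonempty, since the given member A
    serves as the bound of the empty chain.  This is how ideals are enlarged:
    the union of no ideals is not an ideal. *)
Lemma Zorn_above (T : Type) (P : set (set T)) (A : set T) :
    P A ->
    (forall F : set (set T), F !=set0 -> F `<=` P -> total_on F subset ->
      P (\bigcup_(X in F) X)) ->
  exists B, [/\ P B, A `<=` B & forall C, P C -> B `<=` C -> C = B].
Proof.
move=> PA chainP.
(* Adding A to every set lets the empty union stand for A itself. *)
have [|B [PB Bmax]] := @Zorn_bigcup T [set X | P (X `|` A)].
  move=> F FP totF /=.
  pose G := [set X `|` A | X in F] `|` [set A].
  have -> : \bigcup_(X in F) X `|` A = \bigcup_(X in G) X.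
    apply/seteqP; split=> [x [[X FX Xx] | Ax] | x [_ [[X FX <-] | ->]]].
    - by exists (X `|` A); left; [exists X |].
    - by exists A; [right |].
    - by move=> [Xx | Ax]; [left; exists X | right].
    - by right.
  apply: chainP; first by exists A; right.
    by move=> _ [[X FX <-] | ->] //; exact: FP.
  move=> _ _ [[X FX <-] | ->] [[Y FY <-] | ->].
  - by have [XY | YX] := totF _ _ FX FY; [left | right]; exact: setSU.
  - by right; exact: subsetUr.
  - by left; exact: subsetUr.
  - by left.
exists (B `|` A); split=> // C PC BAC.
have AC : A `<=` C by move=> x Ax; apply: BAC; right.
apply/seteqP; split=> // x Cx; left; apply: contrapT => nBx.
have PCA : P (C `|` A) by rewrite (setUidl _).
apply: (Bmax C) PCA; split; first by move=> y By; apply: BAC; left.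
by move=> /(_ x Cx).
Qed.

(** * Maximal right ideals and the Jacobson radical *)

Section RightIdeals.
Variable R : pzRingType.
Implicit Types (I M : set R) (x y : R).

Lemma right_ideal0 I : right_ideal I -> I 0.
Proof. by case=> /additive_subgroupP[]. Qed.

Lemma right_idealB I x y : right_ideal I -> I x -> I y -> I (x - y).
Proof. by case=> /additive_subgroupP[_ IB] _; exact: IB. Qed.

Lemma right_idealM I x y : right_ideal I -> I x -> I (x * y).
Proof. by case=> _; apply. Qed.

Lemma chain_right_ideal (F : set (set R)) :
    F !=set0 -> total_on F subset -> (forall I, F I -> right_ideal I) ->
  right_ideal (\bigcup_(I in F) I).
Proof.
move=> [I0 FI0] totF Fr; split; last first.
  by move=> x r [I FI Ix]; exists I => //; exact: right_idealM (Fr _ FI) Ix.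
apply/additive_subgroupP; split=> [|x y Fx Fy].
  by exists I0 => //; exact: right_ideal0 (Fr _ FI0).
have [I [FI Ix Iy]] := chain_bigcup2 totF Fx Fy.
by exists I => //; exact: right_idealB (Fr _ FI) Ix Iy.
Qed.

Lemma maximal_right_ideal_exists I :
  right_ideal I -> ~ I 1 -> exists2 M, maximal_right_ideal M & I `<=` M.
Proof.
move=> Ir nI1; pose P := [set K : set R | right_ideal K /\ ~ K 1].
have [//|F F0 FP totF | M [[Mr nM1] IM Mmax]] := @Zorn_above R P I.
  split; last by case=> K FK; have [_] := FP _ FK.
  by apply: chain_right_ideal => // K /FP[].
exists M => //; split=> // [MT | K Kr MK]; first by apply: nM1; rewrite MT.
have [K1 | nK1] := pselect (K 1); first by right; exact: right_ideal_unit.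
by left; exact: Mmax.
Qed.

Lemma maximal_right_ideal_not1 M : maximal_right_ideal M -> ~ M 1.
Proof. by case=> Mr MT _ /(right_ideal_unit Mr). Qed.

(** The quotient by a two-sided ideal that is maximal as a right ideal is a
    division ring: for x outside M, the right ideal of the z with x z in M
    contains M and is proper, so it is M. *)
Lemma maximal_right_ideal_prime M x y :
  maximal_right_ideal M -> two_sided_ideal M -> M (x * y) -> M x \/ M y.
Proof.
move=> Mmax [_ [_ Ml]] Mxy; have [Mx | nMx] := pselect (M x); first by left.
have [_ _ /(_ [set z | M (x * z)])] := Mmax.
have [xr xT _] := maximal_right_transporter Mmax nMx.
by case=> // [z | <-]; [exact: Ml | right].
Qed.

Lemma jacobson_right_inverse x : jacobson x -> exists y, (1 - x) * y = 1.
Proof.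
move=> Jx; apply: contrapT => n1x.
pose I := [set (1 - x) * y | y in [set: R]].
have Ir : right_ideal I.
  split; last by move=> _ r [y _ <-]; exists (y * r); rewrite ?mulrA.
  apply/additive_subgroupP; split; first by exists 0; rewrite ?mulr0.
  by move=> _ _ [y _ <-] [z _ <-]; exists (y - z); rewrite ?mulrBr.
have [|M Mmax IM] := maximal_right_ideal_exists Ir.
  by case=> y _ y1; apply: n1x; exists y.
have [Mr _ _] := Mmax; apply: (maximal_right_ideal_not1 Mmax).
rewrite -(subrK x 1); apply: right_idealD => //; last exact: Jx.
by apply: IM; exists 1; rewrite ?mulr1.
Qed.

(** The right inverse y of 1 - x is 1 + x y, which is again right invertible
    as x y is in the radical; so y is a unit and 1 - x is its inverse. *)
Lemma jacobson_left_inverse x : jacobson x -> exists y, y * (1 - x) = 1.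
Proof.
move=> Jx; have [y xy] := jacobson_right_inverse Jx.
have yE : y = 1 - - (x * y) by rewrite opprK -xy mulrBl mul1r subrK.
have [|z] := @jacobson_right_inverse (- (x * y)).
  have [Jr _] := jacobson_two_sided R; rewrite -sub0r.
  by apply: (right_idealB Jr); [exact: right_ideal0 Jr | exact: right_idealM Jr _].
rewrite -yE => yz; exists y.
have zE : z = 1 - x by rewrite -[LHS]mul1r -{1}xy -mulrA yz mulr1.
by rewrite -zE.
Qed.

(** The right ideal x R + M is everything as soon as x is outside M. *)
Lemma maximal_right_ideal_inverse M x :
  maximal_right_ideal M -> ~ M x -> exists y, M (1 - x * y).
Proof.
move=> [Mr _ Mmax] nMx; pose I := [set z | exists y, M (z - x * y)].
have Ir : right_ideal I.
  split.
    apply/additive_subgroupP; split.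
      by exists 0; rewrite mulr0 subr0; exact: right_ideal0 Mr.
    move=> z t [y My] [u Mu]; exists (y - u).
    by rewrite mulrBr opprD addrACA -opprD; exact: right_idealB Mr My Mu.
  move=> z r [y My]; exists (y * r); rewrite mulrA -mulrBl.
  exact: right_idealM Mr My.
have MI : M `<=` I by move=> z Mz; exists 0; rewrite mulr0 subr0.
have [IM | IT] := Mmax _ Ir MI; last first.
  by have : I 1 by rewrite IT.
by case: nMx; rewrite -IM; exists 1; rewrite mulr1 subrr; exact: right_ideal0 Mr.
Qed.

End RightIdeals.

(** If x were outside M, then R x + M = R would put some 1 - y x in M, but this
    element is left invertible.  Maximal left ideals of R are the maximal right
    ideals of the converse ring, definitionally. *)
Lemma jacobson_sub_maximal_left (R : pzRingType) (M : set R) :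
  maximal_left_ideal M -> @jacobson R `<=` M.
Proof.
move=> Mmax x Jx; apply: contrapT => nMx.
have [y My] := @maximal_right_ideal_inverse R^c M x Mmax nMx.
have [_ [_ Jl]] := jacobson_two_sided R.
have [z zE] := jacobson_left_inverse (Jl x y Jx).
have [[_ Ml] _ _] := Mmax.
by apply: (@maximal_right_ideal_not1 R^c M Mmax); rewrite -[1]zE; exact: Ml.
Qed.

Lemma jacobson_converse (R : pzRingType) : @jacobson R^c = @jacobson R.
Proof.
apply/seteqP; split=> x Jx M Mmax.
  exact: (@jacobson_sub_maximal_left R^c M Mmax x Jx).
exact: (@jacobson_sub_maximal_left R M Mmax x Jx).
Qed.

(** * Homogeneous components *)

Section Components.
Variables (R : pzRingType) (Rn : int -> set R).
Hypothesis grR : Z_graded Rn.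
Implicit Types (A : set R) (a b x y : R) (n m k : int).

Lemma graded_subgroup n : additive_subgroup (Rn n).
Proof. by have [] := grR. Qed.

Lemma graded0 n : Rn n 0.
Proof. by have /additive_subgroupP[] := graded_subgroup n. Qed.

Lemma gradedB n a b : Rn n a -> Rn n b -> Rn n (a - b).
Proof. by have /additive_subgroupP[_] := graded_subgroup n; apply. Qed.

Lemma gradedM n m a b : Rn n a -> Rn m b -> Rn (n + m) (a * b).
Proof.
have [_ _ mulR] := grR; move=> Ra Rb; apply: (mulR).
by apply: sub_gen_smallest; exists a => //; exists b.
Qed.

Lemma graded_direct_sum : internal_direct_sum Rn.
Proof. by have [] := grR. Qed.

Definition component x : int -> R := projT1 (cid (graded_direct_sum x)).

Lemma component_graded x n : Rn n (component x n).
Proof. by rewrite /component; case: cid => c /= [[]]. Qed.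

Lemma component_finite x : finite_set [set n | component x n != 0].
Proof. by rewrite /component; case: cid => c /= [[_ finc _] _]. Qed.

Lemma component_sum x : x = \sum_(n \in [set: int]) component x n.
Proof. by rewrite /component; case: cid => c /= [[_ _ xE] _]. Qed.

Lemma component_unique x (c : int -> R) :
    (forall n, Rn n (c n)) -> finite_set [set n | c n != 0] ->
    x = \sum_(n \in [set: int]) c n ->
  component x = c.
Proof.
by rewrite /component; case: cid => d /= [_ dE] Rc finc xE; exact: dE.
Qed.

Lemma homogeneous_ind A :
  additive_subgroup A -> (forall n, Rn n `<=` A) -> forall x, A x.
Proof.
move=> /additive_subgroupP[A0 AB] RA x; rewrite (component_sum x).
apply: big_ind => // [y z Ay Az | n _]; last exact/RA/component_graded.
by rewrite -[z]opprK; apply: (AB) => //; rewrite -sub0r; exact: AB.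
Qed.

Lemma gradedD n a b : Rn n a -> Rn n b -> Rn n (a + b).
Proof.
move=> Ra Rb; rewrite -[b]opprK; apply: gradedB => //.
by rewrite -sub0r; apply: gradedB => //; exact: graded0.
Qed.

Lemma componentD x y n :
  component (x + y) n = component x n + component y n.
Proof.
pose S := [set n | component x n != 0] `|` [set n | component y n != 0].
have finS : finite_set S.
  by rewrite finite_setU; split; exact: component_finite.
have sumS c : (forall n, ~ S n -> c n = 0) ->
    \sum_(n \in [set: int]) c n = \sum_(n \in S) c n :> R.
  by move=> cS; apply/esym/fsbig_widen => // m [_ /cS].
have xS m : ~ S m -> component x m = 0.
  by move=> nSm; apply/eqP/negP => /negP xm; apply: nSm; left.
have yS m : ~ S m -> component y m = 0.
  by move=> nSm; apply/eqP/negP => /negP ym; apply: nSm; right.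
rewrite (@component_unique _ (fun m => component x m + component y m)) //.
- by move=> m; apply: gradedD; exact: component_graded.
- apply: sub_finite_set finS => m /=; apply: contraPP => nSm.
  by rewrite xS // yS // addr0 eqxx.
rewrite {1}(component_sum x) {1}(component_sum y) !sumS //.
  by rewrite fsbig_split.
by move=> m nSm; rewrite xS // yS // addr0.
Qed.

Lemma componentB x y n :
  component (x - y) n = component x n - component y n.
Proof. by apply/eqP; rewrite eq_sym subr_eq -componentD subrK. Qed.

Lemma component_homogeneous n m a :
  Rn n a -> component a m = if m == n then a else 0.
Proof.
move=> Ra.
rewrite (@component_unique _ (fun m => if m == n then a else 0)) // => [k||].
- by case: eqP => [-> //|_]; exact: graded0.
- by apply: (@sub_finite_set _ _ [set n]) => //= k /=; case: (k =P n); rewrite ?eqxx.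
rewrite -(fsbig_widen [set n]) ?fsbig_set1 ?eqxx // => k [_ /= /eqP/negPf ->].
by [].
Qed.

Lemma component0 n : component 0 n = 0.
Proof. by rewrite (component_homogeneous _ (graded0 0)); case: ifP. Qed.

Lemma component_mulr n x a m :
  Rn n a -> component (x * a) m = component x (m - n) * a.
Proof.
move=> Ra; pose A := [set x | forall m, component (x * a) m = component x (m - n) * a].
have: forall x, A x; last exact.
apply: homogeneous_ind => [|k y Ry].
  apply/additive_subgroupP; split=> [|y z Ay Az] i.
    by rewrite mul0r !component0 mul0r.
  by rewrite mulrBl !componentB Ay Az mulrBl.
move=> i; rewrite (component_homogeneous _ (gradedM Ry Ra)).
rewrite (component_homogeneous _ Ry) subr_eq.
by case: eqP => //; rewrite mul0r.
Qed.

Lemma component_mull n x a m :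
  Rn n a -> component (a * x) m = a * component x (m - n).
Proof.
move=> Ra; pose A := [set x | forall m, component (a * x) m = a * component x (m - n)].
have: forall x, A x; last exact.
apply: homogeneous_ind => [|k y Ry].
  apply/additive_subgroupP; split=> [|y z Ay Az] i.
    by rewrite mulr0 !component0 mulr0.
  by rewrite mulrBr !componentB Ay Az mulrBr.
move=> i; rewrite (component_homogeneous _ (gradedM Ra Ry)).
rewrite (component_homogeneous _ Ry) subr_eq addrC.
by case: eqP => //; rewrite mulr0.
Qed.

(** The degree 0 component of 1 is a left identity on homogeneous elements, by
    comparing degrees in 1 a = a, hence on all of R, so that it equals 1. *)
Lemma graded1 : Rn 0 1.
Proof.
suff : forall x, component 1 0 * x = x.
  by move=> /(_ 1); rewrite mulr1 => <-; exact: component_graded.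
apply: homogeneous_ind => [|n a Ra].
  apply/additive_subgroupP; split=> [|x y Ax Ay]; first by rewrite mulr0.
  by rewrite mulrBr Ax Ay.
have := component_mulr 1 n Ra; rewrite mul1r subrr => <-.
by rewrite (component_homogeneous _ Ra) eqxx.
Qed.

Lemma component_bounded x :
  exists N : nat, forall n, (N <= `|n|)%N -> component x n = 0.
Proof.
pose A := [set x | exists N : nat, forall n, (N <= `|n|)%N -> component x n = 0].
have: forall x, A x; last exact.
apply: homogeneous_ind => [|n a Ra].
  apply/additive_subgroupP; split=> [|y z [N yN] [K zK]].
    by exists 0%N => n _; rewrite component0.
  exists (maxn N K) => n; rewrite geq_max => /andP[Nn Kn].
  by rewrite componentB yN // zK // subrr.
exists `|n|.+1 => m nm; rewrite (component_homogeneous _ Ra).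
by case: eqP nm => // ->; rewrite ltnn.
Qed.

(** * Graded primes *)

(** Primeness is required for products of homogeneous elements only, without
    inserting an arbitrary factor between them: the graded quotient is a
    graded domain.  The unit ideal is allowed; properness always comes from
    avoiding some element. *)
Definition graded_prime (Q : set R) : Prop :=
  [/\ two_sided_ideal Q,
      forall x n, Q x -> Q (component x n) &
      forall n m a b, Rn n a -> Rn m b -> Q (a * b) -> Q a \/ Q b].

(** The largest graded ideal contained in M, when M is an ideal. *)
Definition graded_part (M : set R) : set R :=
  [set x | forall n, M (component x n)].

Lemma graded_part_sub M : additive_subgroup M -> graded_part M `<=` M.
Proof.
move=> /additive_subgroupP[M0 MB] x Mx; rewrite (component_sum x).
apply: big_ind => // y z My Mz.
by rewrite -[z]opprK; apply: (MB) => //; rewrite -sub0r; exact: MB.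
Qed.

Lemma graded_part_homogeneous M n a :
  Rn n a -> M 0 -> M a -> graded_part M a.
Proof. by move=> Ra M0 Ma m; rewrite (component_homogeneous _ Ra); case: eqP. Qed.

(** A graded part is closed under multiplication by homogeneous elements, since
    these only shift degrees, and then by all elements by additivity. *)
Lemma graded_part_prime M :
  maximal_right_ideal M -> two_sided_ideal M -> graded_prime (graded_part M).
Proof.
move=> Mmax M2; have [[Msub Mr] [_ Ml]] := M2.
have /additive_subgroupP[M0 MB] := Msub.
have subM : additive_subgroup (graded_part M).
  apply/additive_subgroupP; split=> [n | x y Mx My n].
    by rewrite component0.
  by rewrite componentB; apply: MB.
split=> [|x n Mx m | n m a b Ra Rb Mab].
- split; split=> // x r Mx; move: r; apply: homogeneous_ind => [|n a Ra].
  + apply/additive_subgroupP; split=> [n|y z My Mz n].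
      by rewrite mulr0 component0.
    by rewrite mulrBr componentB; apply: MB.
  + by move=> m; rewrite (component_mulr _ _ Ra); exact: Mr.
  + apply/additive_subgroupP; split=> [n|y z My Mz n].
      by rewrite mul0r component0.
    by rewrite mulrBl componentB; apply: MB.
  + by move=> m; rewrite (component_mull _ _ Ra); exact: Ml.
- by rewrite (component_homogeneous _ (component_graded x n)); case: eqP.
have := graded_part_sub Msub Mab.
case/(maximal_right_ideal_prime Mmax M2) => [Ma | Mb]; [left | right].
  exact: graded_part_homogeneous Ra M0 Ma.
exact: graded_part_homogeneous Rb M0 Mb.
Qed.

Lemma chain_graded_prime (F : set (set R)) :
    F !=set0 -> total_on F subset -> (forall Q, F Q -> graded_prime Q) ->
  graded_prime (\bigcup_(Q in F) Q).
Proof.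
move=> F0 totF Fp.
have Fr : right_ideal (\bigcup_(Q in F) Q).
  by apply: chain_right_ideal => // Q /Fp[[]].
split.
- split=> //; split; first by case: Fr.
  move=> x r [Q FQ Qx]; exists Q => //.
  by have [[_ [_ Ql]] _ _] := Fp _ FQ; exact: Ql.
- by move=> x n [Q FQ Qx]; exists Q => //; have [_ Qc _] := Fp _ FQ; exact: Qc.
move=> n m a b Ra Rb [Q FQ Qab]; have [_ _ Qp] := Fp _ FQ.
by have [Qa | Qb] := Qp _ _ _ _ Ra Rb Qab; [left | right]; exists Q.
Qed.

(** In a graded domain, if (1 - w) r = 1 with w nonzero of degree n <> 0, then
    comparing components gives r_(kn) = w r_((k-1)n) for k <> 0, and
    r_0 = 1 + w r_(-n).  Components far in the negative direction vanish, hence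
    so do all the negative ones, which leaves r_(kn) = w ^ k for all k >= 0:
    r would have infinitely many nonzero components.  The argument is run
    modulo Q. *)
Lemma one_sub_proper Q n w :
    graded_prime Q -> n != 0 -> Rn n w -> ~ Q w ->
  forall r, ~ Q (1 - (1 - w) * r).
Proof.
move=> [[Qr [_ Ql]] Qc Qp] n0 Rw nQw r Q1.
have QB x y : Q x -> Q y -> Q (x - y) by exact: right_idealB Qr.
have QD x y : Q x -> Q y -> Q (x + y) by exact: right_idealD Qr.
have Q0 : Q 0 by exact: right_ideal0 Qr.
have nQ1 : ~ Q 1 by move=> Q1'; apply: nQw; rewrite -[w]mulr1; exact: Ql.
pose c (k : int) := component r (n * k).
have crec k : Q ((if k == 0 then 1 else 0) - (c k - w * c (k - 1))).
  have := Qc _ (n * k) Q1.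
  rewrite componentB (component_homogeneous _ graded1) mulrBl mul1r componentB.
  by rewrite (component_mull _ _ Rw) mulf_eq0 (negPf n0) /c mulrBr mulr1.
have crecN k : k != 0 -> Q (w * c (k - 1) - c k).
  by move=> /negPf k0; have := crec k; rewrite k0 sub0r opprB.
have [N rN] := component_bounded r.
have cN k : (N <= `|k|)%N -> c k = 0.
  move=> Nk; apply: rN; rewrite abszM (leq_trans Nk) // leq_pmull //.
  by rewrite absz_gt0.
(* Induction on the distance j from the range where the components vanish. *)
have Qneg (j k : nat) : (N <= k.+1 + j)%N -> Q (c (- k.+1%:Z)).
  elim: j k => [|j IHj] k Njk.
    by rewrite cN //; lia.
  have := crecN (- k.+1%:Z); have -> : - k.+1%:Z - 1 = - k.+2%:Z by lia.
  have Qk2 : Q (w * c (- k.+2%:Z)) by apply/Ql/IHj; lia.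
  by move=> /(_ isT)/(QB _ _ Qk2); rewrite subKr.
have Qpow (k : nat) : Q (w ^+ k - c k%:Z).
  elim: k => [|k IHk].
    have Qw : Q (w * c (- 1%:Z)) by apply/Ql/(Qneg N 0%N); lia.
    by have := QB _ _ (crec 0) Qw; rewrite eqxx opprB addrA addrAC addrK.
  have := crecN k.+1%:Z; have -> : k.+1%:Z - 1 = k%:Z by lia.
  move=> /(_ isT) Qk; have := QD _ _ (Ql _ w IHk) Qk.
  by rewrite exprS mulrBr addrA subrK.
have nQpow (k : nat) : ~ Q (w ^+ k) /\ Rn (n * k%:Z) (w ^+ k).
  elim: k => [|k [nQk Rk]]; first by rewrite expr0 mulr0; split=> //; exact: graded1.
  rewrite exprS; split.
    by case/(Qp _ _ _ _ Rw Rk).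
  have -> : n * k.+1%:Z = n + n * k%:Z by rewrite intS mulrDr mulr1.
  exact: gradedM.
by have := Qpow N; rewrite cN // subr0; case: (nQpow N).
Qed.


Lemma graded_prime_maximal_avoiding Q c :
    graded_prime Q -> ~ Q c ->
  exists Q', [/\ graded_prime Q', ~ Q' c, Q `<=` Q' &
    forall P, graded_prime P -> ~ P c -> Q' `<=` P -> P = Q'].
Proof.
move=> Qp nQc; pose P := [set K : set R | graded_prime K /\ ~ K c].
have [//|F F0 FP totF | Q' [[Q'p nQ'c] QQ' Q'max]] := @Zorn_above R P Q.
  split; last by case=> K FK; have [_] := FP _ FK.
  by apply: chain_graded_prime => // K /FP[].
by exists Q'; split=> // K Kp nKc; exact: Q'max.
Qed.

End Components.

(** * Commutators in right quasi-duo strongly graded rings *)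

Section RightQuasiDuo.
Variables (R : pzRingType) (Rn : int -> set R).
Hypotheses (strongR : strongly_Z_graded Rn) (duoR : right_quasi_duo R).
Implicit Types (a b c x y w v : R) (n m k : int).

Let grR : Z_graded Rn := strongR.1.

(** This is where strong grading enters: 1 is a sum of products of elements of
    degree n and -n, so an ideal containing all of R_n contains 1. *)
Lemma exists_homogeneous_notin (Q : set R) n :
  two_sided_ideal Q -> ~ Q 1 -> exists2 y, Rn n y & ~ Q y.
Proof.
move=> [Qr _] nQ1; apply: contrapT => RQ; apply: nQ1.
have : Rn (n - n) 1 by rewrite subrr; exact: graded1 grR.
rewrite -(strongR.2 n (- n)); apply: smallest_sub; first by case: Qr.
move=> _ [y Ry [z Rz <-]]; apply: (right_idealM _ Qr).
by apply: contrapT => nQy; apply: RQ; exists y.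
Qed.

(** A maximal right ideal M over Q + (1 - c w) R avoids c, so by maximality of Q
    its graded part is Q.  It is two-sided, hence contains the commutator of v
    with 1 - c w, which is homogeneous and therefore falls into Q. *)
Lemma homogeneous_central_mod (Q : set R) c n m w k v :
    graded_prime grR Q -> ~ Q c ->
    (forall P, graded_prime grR P -> ~ P c -> Q `<=` P -> P = Q) ->
    Rn n c -> n + m != 0 -> Rn m w -> Rn k v ->
  Q (c * w * v - v * (c * w)).
Proof.
move=> Qp nQc Qmax Rc nm0 Rw Rv.
have [[Qr [_ Ql]] _ _] := Qp.
have Rcw := gradedM grR Rc Rw.
(* When c w is in Q the claim is trivial, and 1 - c w would be a unit mod Q. *)
have [Qcw | nQcw] := pselect (Q (c * w)).
  apply: (right_idealB Qr); last exact: Ql.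
  exact: right_idealM Qr Qcw.
pose I := [set x | exists r, Q (x - (1 - c * w) * r)].
have Ir : right_ideal I.
  split.
    apply/additive_subgroupP; split.
      by exists 0; rewrite mulr0 subr0; exact: right_ideal0 Qr.
    move=> x y [r Qx] [s Qy]; exists (r - s).
    by rewrite mulrBr opprD addrACA -opprD; exact: right_idealB Qr Qx Qy.
  move=> x s [r Qx]; exists (r * s); rewrite mulrA -mulrBl.
  exact: right_idealM Qr Qx.
have [|M Mmax IM] := maximal_right_ideal_exists Ir.
  by case=> r; exact: one_sub_proper Qp nm0 Rcw nQcw r.
have [[Msub Mr] [_ Ml]] := duoR Mmax.
have QM : Q `<=` M.
  by move=> x Qx; apply: IM; exists 0; rewrite mulr0 subr0.
have M1cw : M (1 - c * w).
  by apply: IM; exists 1; rewrite mulr1 subrr; exact: right_ideal0 (Qr).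
have MR : right_ideal M by have [] := Mmax.
have nMc : ~ M c.
  move=> Mc; apply: (maximal_right_ideal_not1 Mmax).
  by rewrite -(subrK (c * w) 1); apply: (right_idealD MR) => //; exact: Mr.
have Mp := graded_part_prime grR Mmax (duoR Mmax).
have Qsub : Q `<=` graded_part grR M.
  by move=> x Qx i; apply: QM; have [_ Qc _] := Qp; exact: Qc.
rewrite -(Qmax _ Mp _ Qsub).
  apply: (@graded_part_homogeneous _ _ grR M (n + m + k)).
  - apply: (gradedB grR); first exact: gradedM.
    by rewrite addrC; exact: gradedM.
  - exact: right_ideal0 MR.
  have -> : c * w * v - v * (c * w) = v * (1 - c * w) - (1 - c * w) * v.
    by rewrite mulrBr mulrBl mulr1 mul1r opprB [RHS]addrC addrA subrK.
  by apply: (right_idealB MR); [exact: Ml | exact: Mr].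
by move=> /(graded_part_sub Msub)/nMc.
Qed.

(** Modulo the maximal graded prime Q avoiding c, both c y and c (y b) commute
    with a; so c y a b = a c y b = c y b a, that is c y c = 0, against the
    primeness of Q. *)
Lemma homogeneous_commutator_maximal (M : set R) n m a b :
  maximal_right_ideal M -> Rn n a -> Rn m b -> M (a * b - b * a).
Proof.
move=> Mmax Ra Rb; apply: contrapT; set c := a * b - b * a => nMc.
have Rc : Rn (n + m) c.
  by apply: (gradedB grR); [|rewrite addrC]; exact: gradedM.
have [||Q [Qp nQc _ Qmax]] := @graded_prime_maximal_avoiding _ _ grR (graded_part grR M) c.
- exact: graded_part_prime (duoR Mmax).
- by have [[Msub _] _] := duoR Mmax; move=> /(graded_part_sub Msub).
have [Q2 _ Qprime] := Qp; have [Qr [_ Ql]] := Q2.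
have nQ1 : ~ Q 1 by move=> Q1; apply: nQc; rewrite -[c]mulr1; exact: Ql.
apply: (nQc).
(* A degree k for y such that neither c y nor c (y b) has degree 0. *)
have [k [k0 kb0]] : exists k, n + m + k != 0 /\ n + m + (k + m) != 0.
  have [-> | m1] := eqVneq m (-1).
    by exists (2 - (n - 1)); split; lia.
  by exists (1 - (n + m)); split; lia.
have [y Ry nQy] := exists_homogeneous_notin k Q2 nQ1.
have Qya := homogeneous_central_mod Qp nQc Qmax Rc k0 Ry Ra.
have Qyba := homogeneous_central_mod Qp nQc Qmax Rc kb0 (gradedM grR Ry Rb) Ra.
have : Q (c * y * c).
  have -> : c * y * c = (c * y * a - a * (c * y)) * b -
                        (c * (y * b) * a - a * (c * (y * b))).
    rewrite [in RHS]mulrBl !mulrA opprB addrA subrK.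
    by rewrite {2}/c mulrBr !mulrA.
  by apply: (right_idealB Qr) => //; exact: right_idealM Qr Qya.
case/(Qprime _ _ _ _ (gradedM grR Rc Ry) Rc) => // Qcy.
by case: (Qprime _ _ _ _ Rc Ry Qcy).
Qed.

Lemma commutator_maximal (M : set R) a b :
  maximal_right_ideal M -> M (a * b - b * a).
Proof.
move=> Mmax; have MR : right_ideal M by have [] := Mmax.
have M0 := right_ideal0 MR.
move: b; apply: (homogeneous_ind grR) => [|m b Rb].
  apply/additive_subgroupP; split=> [|x y Mx My].
    by rewrite mulr0 mul0r subrr.
  suff -> : a * (x - y) - (x - y) * a = (a * x - x * a) - (a * y - y * a).
    exact: right_idealB MR Mx My.
  by rewrite mulrBr mulrBl !opprB addrACA [RHS]addrACA [X in _ + X = _]addrC.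
move: a; apply: (homogeneous_ind grR) => [|n a Ra].
  apply/additive_subgroupP; split=> [|x y Mx My].
    by rewrite mulr0 mul0r subrr.
  suff -> : (x - y) * b - b * (x - y) = (x * b - b * x) - (y * b - b * y).
    exact: right_idealB MR Mx My.
  by rewrite mulrBr mulrBl !opprB addrACA [RHS]addrACA [X in _ + X = _]addrC.
exact: homogeneous_commutator_maximal Mmax Ra Rb.
Qed.
End RightQuasiDuo.

(** * Passing to the other side and to the quotient *)

Lemma strongly_graded_converse (R : pzRingType) (Rn : int -> set R) :
  strongly_Z_graded Rn -> @strongly_Z_graded R^c Rn.
Proof.
have mulC (A B : set R) : @mul_subgroup R^c A B = mul_subgroup B A.
  congr smallest; apply/seteqP; split=> x [a Aa [b Bb <-]];
    by exists b => //; exists a.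
move=> [[subR sumR mulR] strongR]; split; last first.
  by move=> n m; rewrite mulC strongR addrC.
by split=> // n m; rewrite mulC addrC; exact: mulR.
Qed.

Lemma quot_jacobson_comm (R : pzRingType) :
  (forall u v : quot_jacobson R, u * v = v * u) <->
  (forall a b : R, jacobson (a * b - b * a)).
Proof.
split=> [comm a b | comm u v].
  by apply/pi_jacobson_eq; rewrite !pi_jacobsonM.
rewrite -[u]reprK -[v]reprK -!pi_jacobsonM.
by apply/pi_jacobson_eq.
Qed.

(** Every additive subgroup containing J(R) and closed under right
    multiplication is closed under left multiplication, as r x and x r agree
    modulo J(R). *)
Lemma right_quasi_duo_of_commutators (R : pzRingType) :
  (forall a b : R, jacobson (a * b - b * a)) -> right_quasi_duo R.
Proof.
move=> comm M Mmax; have [Mr _ _] := Mmax; have [Msub Mm] := Mr.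
split=> //; split=> // x r Mx; rewrite -(subrK (x * r) (r * x)).
by apply: (right_idealD Mr); [exact: comm | exact: Mm].
Qed.

Lemma left_quasi_duo_converse (R : pzRingType) :
  left_quasi_duo R <-> right_quasi_duo R^c.
Proof. by split=> duoR M /duoR[]; split. Qed.

Lemma right_quasi_duo_iff_commutators (R : pzRingType) (Rn : int -> set R) :
    strongly_Z_graded Rn ->
  right_quasi_duo R <-> (forall a b : R, jacobson (a * b - b * a)).
Proof.
move=> strongR; split=> [duoR a b M | ].
  exact: commutator_maximal strongR duoR M a b.
exact: right_quasi_duo_of_commutators.
Qed.

Theorem corollary7 (R : pzRingType) (Rn : int -> set R)
    (hR : strongly_Z_graded Rn) :
  (right_quasi_duo R <-> left_quasi_duo R) /\
  (left_quasi_duo R <-> (forall u v : quot_jacobson R, u * v = v * u)).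
Proof.
have rightE := right_quasi_duo_iff_commutators hR.
have leftE := right_quasi_duo_iff_commutators (strongly_graded_converse hR).
rewrite -left_quasi_duo_converse jacobson_converse in leftE.
have commC : (forall a b : R^c, @jacobson R (a * b - b * a)) <->
             (forall a b : R, jacobson (a * b - b * a)).
  by split=> comm a b; exact: comm b a.
by rewrite quot_jacobson_comm rightE leftE commC.
Qed.
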